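(* $\mathsf{GS4}$ has infinitely many $\{\neg,\Box,\Diamond\}$-modalities.
   Context: Fix a (nonempty) set $\mathrm{Prop}$ of propositional symbols. Modal formulas are given by the grammar $\varphi := \bot \mid p \mid \varphi\land\varphi \mid \varphi\lor\varphi \mid \varphi\to\varphi \mid \Box\varphi \mid \Diamond\varphi$ with $p\in\mathrm{Prop}$; $\Box$ and $\Diamond$ are not interdefinable. Put $\neg\varphi := \varphi\to\bot$. A relation is a preorder if it is reflexive and transitive. For a relation $R$ on $W$, a set $A\subseteq W$ is an $R$-upset iff $w\in A$ and $wRv$ imply $v\in A$. A birelational $\mathsf{CS4}$-model is a tuple $M=\langle W, W^\bot, \preceq, \sqsubseteq, V\rangle$ where $W$ is a set of worlds, $W^\bot\subseteq W$ is the set of fallible worlds, $\preceq$ and $\sqsubseteq$ are preorders on $W$, and $V:\mathrm{Prop}\to\mathcal{P}(W)$, such that: (i) $M$ is backward confluent: $w\sqsubseteq v\preceq v'$ implies there is $w'$ with $w\preceq w'$ and $w'\sqsubseteq v'$; (ii) for every $p\in\mathrm{Prop}$, $V(p)$ is a $\preceq$-upset and $W^\bot\subseteq V(p)$; (iii) $W^\bot$ is both a $\preceq$-upset and a $\sqsubseteq$-upset. A $\mathsf{GS4}$-model is a $\mathsf{CS4}$-model with $W^\bot=\emptyset$ which is (backward confluent and) forward confluent: $w\sqsubseteq v$ and $w\preceq w'$ imply there is $v'$ with $w'\sqsubseteq v'$ and $v\preceq v'$; and locally linear: $w\preceq v$ and $w\preceq u$ imply $v\preceq u$ or $u\preceq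 v$. Truth: $M,w\models p$ iff $w\in V(p)$; $M,w\models\bot$ iff $w\in W^\bot$; $\land,\lor$ are evaluated pointwise; $M,w\models\varphi\to\psi$ iff for all $v$ with $w\preceq v$, $M,v\models\varphi$ implies $M,v\models\psi$; $M,w\models\Box\varphi$ iff for all $v,u$ with $w\preceq v$ and $v\sqsubseteq u$, $M,u\models\varphi$; $M,w\models\Diamond\varphi$ iff for all $v$ with $w\preceq v$ there is $u$ with $v\sqsubseteq u$ and $M,u\models\varphi$. Write $\|\varphi\|^M := \{w\in W\mid M,w\models\varphi\}$. For $X\subseteq\{\neg,\Box,\Diamond\}$, an $X$-modality is a finite (possibly empty) sequence $\sigma\in X^{<\omega}$; $\sigma\varphi$ denotes the formula obtained by prefixing $\sigma$ to $\varphi$. Modalities $\sigma,\tau$ are $\mathsf{GS4}$-equivalent if $\|\sigma\varphi\|^M=\|\tau\varphi\|^M$ for every $\mathsf{GS4}$-model $M$ and every formula $\varphi$. $\mathsf{GS4}$ has finitely many $X$-modalities iff there is a finite set $\Sigma\subseteq X^{<\omega}$ such that every $X$-modality is $\mathsf{GS4}$-equivalent to some $\sigma\in\Sigma$; otherwise it has infinitely many $X$-modalities. *)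

(* Defs.v *)
(* Only the standard library is used. Subsets of a type are [Ensemble]s, and
   equality of subsets is the extensional [Same_set]. *)
From Stdlib Require Import Relation_Definitions Ensembles List.
Set Implicit Arguments.
Unset Strict Implicit.

Inductive formula (Atom : Type) : Type :=
| Bot : formula Atom
| Var : Atom -> formula Atom
| And : formula Atom -> formula Atom -> formula Atom
| Or : formula Atom -> formula Atom -> formula Atom
| Imp : formula Atom -> formula Atom -> formula Atom
| Box : formula Atom -> formula Atom
| Dia : formula Atom -> formula Atom.
Arguments Bot {Atom}.

Definition Neg (Atom : Type) (phi : formula Atom) : formula Atom := Imp phi Bot.

Definition upset (W : Type) (R : relation W) (A : Ensemble W) : Prop :=
  forall w v, A w -> R w v -> A v.

(* In the following, [le] is the intuitionistic relation and [acc] the modal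
   one. *)
Definition backward_confluent (W : Type) (le acc : relation W) : Prop :=
  forall w v v', acc w v -> le v v' -> exists w', le w w' /\ acc w' v'.

Definition forward_confluent (W : Type) (le acc : relation W) : Prop :=
  forall w v w', acc w v -> le w w' -> exists v', acc w' v' /\ le v v'.

Definition locally_linear (W : Type) (le : relation W) : Prop :=
  forall w v u, le w v -> le w u -> le v u \/ le u v.

Record cs4_model (Atom : Type) : Type := CS4Model {
  world : Type;
  fallible : Ensemble world;
  le : relation world;
  acc : relation world;
  val : Atom -> Ensemble world;
  le_preorder : preorder world le;
  acc_preorder : preorder world acc;
  le_acc_backward : backward_confluent le acc;
  val_upset : forall p, upset le (val p);
  fallible_val : forall p, Included world fallible (val p);
  fallible_le_upset : upset le fallible;
  fallible_acc_upset : upset acc fallible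
}.
Arguments fallible {Atom} M : rename.
Arguments le {Atom} M : rename.
Arguments acc {Atom} M : rename.
Arguments val {Atom} M : rename.

(* Backward confluence is already part of [cs4_model]. *)
Definition is_gs4 (Atom : Type) (M : cs4_model Atom) : Prop :=
  Same_set (world M) (fallible M) (Empty_set (world M)) /\
  forward_confluent (le M) (acc M) /\
  locally_linear (le M).

Fixpoint sat (Atom : Type) (M : cs4_model Atom) (w : world M)
    (phi : formula Atom) : Prop :=
  match phi with
  | Bot => fallible M w
  | Var p => val M p w
  | And a b => sat w a /\ sat w b
  | Or a b => sat w a \/ sat w b
  | Imp a b => forall v, le M w v -> sat v a -> sat v b
  | Box a => forall v u, le M w v -> acc M v u -> sat u a
  | Dia a => forall v, le M w v -> exists u, acc M v u /\ sat u a
  end.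

Definition truth_set (Atom : Type) (M : cs4_model Atom) (phi : formula Atom)
  : Ensemble (world M) := fun w => sat w phi.
Arguments truth_set {Atom} M phi w.

Inductive modal_op : Set := OpNeg | OpBox | OpDia.

Definition apply_op (Atom : Type) (o : modal_op) (phi : formula Atom)
  : formula Atom :=
  match o with
  | OpNeg => Neg phi
  | OpBox => Box phi
  | OpDia => Dia phi
  end.

(* The head of the list is the outermost operator. *)
Definition prefix (Atom : Type) (sigma : list modal_op) (phi : formula Atom)
  : formula Atom := fold_right (@apply_op Atom) phi sigma.

Definition is_modality (X : Ensemble modal_op) (sigma : list modal_op) : Prop :=
  Forall X sigma.

Definition gs4_equiv (Atom : Type) (sigma tau : list modal_op) : Prop :=
  forall M : cs4_model Atom, is_gs4 M ->
  forall phi : formula Atom,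
    Same_set (world M) (truth_set M (prefix sigma phi))
                       (truth_set M (prefix tau phi)).

(* The finite set of representatives is given by a list enumerating it. *)
Definition gs4_finitely_many_modalities (Atom : Type) (X : Ensemble modal_op)
  : Prop :=
  exists Sigma : list (list modal_op),
    (forall sigma, List.In sigma Sigma -> is_modality X sigma) /\
    (forall tau, is_modality X tau ->
       exists sigma, List.In sigma Sigma /\ gs4_equiv Atom tau sigma).

Definition gs4_infinitely_many_modalities (Atom : Type)
    (X : Ensemble modal_op) : Prop :=
  ~ gs4_finitely_many_modalities Atom X.

(* Main.v *)
Require Import Defs.
From Stdlib Require Import Ensembles.
From Stdlib Require Import Relation_Definitions List Permutation Lia.

(** The powers of the single modality [¬¬□◇] are already pairwise inequivalent,
    and one model shows it.

    Local linearity makes a negated formula constant along [le], so [¬¬]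
    forgets the stage of the [le]-chain at which a formula becomes true and
    retains only that it does so eventually.  Hence [¬¬□◇ chi] says of a chain
    that from some stage on, all modal successors have a modal successor in
    [chi].  One application can absorb one delay, and repeated delays need
    repeated applications.

    In the model, each pair [(d, j)] carries a chain of stages indexed by
    [nat].  A chain of height [d] and delay [j] sees, from stage [j] on, every
    chain of smaller height, whatever its delay; before that it sees only
    itself.  Modal steps preserve the stage.  If [chi] holds exactly on the
    chains of height at most [e], then [¬¬□◇ chi] holds exactly on those of
    height at most [S e] ([sat_eventually_box_dia]).  A chain of height [S e]
    reaches [chi] once its own delay is over.  A taller chain sees, at every
    late stage [m], a chain of height above [e] whose delay [S m] is not over,
    so no stage works.

    Starting from a variable true at height [0], the [n]-th power thus defines
    the set of heights at most [n], and the pigeonhole principle excludes a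
    finite set of representatives. *)

Section DelayModel.

Variable Atom : Type.

Record point : Type := Point { height : nat; delay : nat; stage : nat }.

Definition later (w v : point) : Prop :=
  height w = height v /\ delay w = delay v /\ stage w <= stage v.

Definition sees (w v : point) : Prop :=
  stage w = stage v /\
  (height w = height v /\ delay w = delay v \/
   height v < height w /\ delay w <= stage w).

Lemma later_preorder : preorder point later.
Proof. split; unfold later; red; intros; lia. Qed.

Lemma sees_preorder : preorder point sees.
Proof. split; unfold sees; red; intros; lia. Qed.

Lemma later_sees_backward : backward_confluent later sees.
Proof.
  intros w v v' Hwv Hv.
  exists (Point (height w) (delay w) (stage v')).
  unfold later, sees in *; simpl; lia.
Qed.

Lemma later_sees_forward : forward_confluent later sees.
Proof.
  intros w v w' Hwv Hw.
  exists (Point (height v) (delay v) (stage w')).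
  unfold later, sees in *; simpl; lia.
Qed.

Lemma later_locally_linear : locally_linear later.
Proof. intros w v u; unfold later; lia. Qed.

Lemma height0_upset (p : Atom) : upset later (fun w => height w = 0).
Proof. intros w v; unfold later; lia. Qed.

Definition delay_model : cs4_model Atom.
Proof.
  refine (@CS4Model Atom point (Empty_set point) later sees
            (fun _ w => height w = 0)
            later_preorder sees_preorder later_sees_backward
            height0_upset _ _ _).
  - intros p w [].
  - intros w v [].
  - intros w v [].
Defined.

Lemma delay_model_gs4 : is_gs4 delay_model.
Proof.
  split; [split; intros w Hw; exact Hw |].
  exact (conj later_sees_forward later_locally_linear).
Qed.

Definition eventually_box_dia : list modal_op :=
  OpNeg :: OpNeg :: OpBox :: OpDia :: nil.

(** Both directions compare the current stage with the delay: [¬¬] allows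
    passing to a stage where the delay of the point itself is over, but the
    delays of its modal successors are unbounded at every stage. *)
Lemma sat_eventually_box_dia (chi : formula Atom) (e : nat) :
  (forall w : world delay_model, sat w chi <-> height w <= e) ->
  forall w : world delay_model,
    sat w (prefix eventually_box_dia chi) <-> height w <= S e.
Proof.
  intros Hchi w; split.
  - intros Hw.
    destruct (Compare_dec.le_lt_dec (height w) (S e)) as [Hle | Hlt];
      [exact Hle | exfalso].
    destruct (Hw w) as []; [unfold le; simpl; unfold later; lia |].
    intros v Hwv Hv; exfalso.
    (* A successor of height above [e] whose delay expires one stage too late. *)
    set (m := max (stage v) (delay v)).
    pose (u := Point (pred (height v)) (S m) m).
    assert (Hmu : sees (Point (height v) (delay v) m) u)
      by (simpl in Hwv; unfold later in Hwv; unfold sees, u; simpl; lia).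
    assert (Hvm : later v (Point (height v) (delay v) m))
      by (unfold later; simpl; lia).
    destruct (Hv _ _ Hvm Hmu u) as [x [Hux Hx]];
      [simpl; unfold later; lia |].
    apply Hchi in Hx.
    simpl in Hux, Hwv; unfold sees, u in Hux; unfold later in Hwv;
      simpl in Hux; lia.
  - intros Hw v Hwv Hv.
    (* Wait until the delay of the chain through [v] is over. *)
    destruct (Hv (Point (height v) (delay v) (max (stage v) (delay v)))) as [];
      [simpl; unfold later; simpl; lia |].
    intros v' u Hv' Hu u' Hu'.
    simpl in Hwv, Hv', Hu, Hu'; unfold later, sees in *; simpl in Hv'.
    destruct (Compare_dec.le_lt_dec (height u') e) as [Hle | Hlt].
    + exists u'; split; [simpl; unfold sees; lia | apply Hchi; exact Hle].
    + (* Here [height u'] is the maximal value [S e], so [u'] lies on the chain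
         of [v] and its delay is over. *)
      exists (Point e 0 (stage u')); split;
        [simpl; unfold sees; simpl; lia | apply Hchi; simpl; lia].
Qed.

Definition eventually_box_dia_pow (n : nat) : list modal_op :=
  concat (repeat eventually_box_dia n).

Lemma sat_eventually_box_dia_pow (p : Atom) (n : nat)
    (w : world delay_model) :
  sat w (prefix (eventually_box_dia_pow n) (Var p)) <-> height w <= n.
Proof.
  revert w; induction n as [| n IH].
  - intros w; simpl; lia.
  - exact (sat_eventually_box_dia _ n IH).
Qed.

Lemma eventually_box_dia_pow_inj (p : Atom) (n m : nat) (sigma : list modal_op) :
  gs4_equiv Atom (eventually_box_dia_pow n) sigma ->
  gs4_equiv Atom (eventually_box_dia_pow m) sigma ->
  n = m.
Proof.
  intros Hn Hm.
  destruct (Hn _ delay_model_gs4 (Var p)) as [Hn1 Hn2].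
  destruct (Hm _ delay_model_gs4 (Var p)) as [Hm1 Hm2].
  assert (H : forall w : world delay_model, height w <= n <-> height w <= m).
  { intros w; rewrite <- !(sat_eventually_box_dia_pow p).
    split; intros Hw; [apply Hm2, Hn1 | apply Hn2, Hm1]; exact Hw. }
  pose proof (proj1 (H (Point n 0 0)) (le_n n)).
  pose proof (proj2 (H (Point m 0 0)) (le_n m)).
  simpl in *; lia.
Qed.

End DelayModel.

Lemma eventually_box_dia_pow_modality (n : nat) :
  is_modality (Triple modal_op OpNeg OpBox OpDia) (eventually_box_dia_pow n).
Proof.
  apply Forall_forall; intros [] _; constructor.
Qed.

Theorem theorem14 (Atom : Type) (Atom_nonempty : inhabited Atom) :
  gs4_infinitely_many_modalities Atom (Triple modal_op OpNeg OpBox OpDia).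
Proof.
  destruct Atom_nonempty as [p].
  intros [Sigma [_ Hrep]].
  pose (R n sigma := gs4_equiv Atom (eventually_box_dia_pow n) sigma).
  destruct (@Permutation_pigeonhole_rel _ _ R (seq 0 (S (length Sigma))) Sigma)
    as (n & m & l & Hperm & sigma & _ & Hn & Hm).
  - apply Forall_forall; intros n _; apply Exists_exists.
    exact (Hrep _ (eventually_box_dia_pow_modality n)).
  - rewrite length_seq; lia.
  - pose proof (Permutation_NoDup Hperm (seq_NoDup _ _)) as Hnodup.
    inversion Hnodup as [| ? ? Hnotin]; subst.
    apply Hnotin; left; symmetry.
    exact (eventually_box_dia_pow_inj _ p _ _ _ Hn Hm).
Qed.
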